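(* Every closed $\mu$--Darboux transform $\hat f:T^2\to\mathbb R^4$ of a Hamiltonian stationary torus $f:T^2\to\mathbb R^4$ is a monochromatic Darboux transform of $f$, and vice versa.
   Context: Identify $\mathbb R^4$ with $\mathbb H$ and $\mathbb C$ with $\mathrm{span}_{\mathbb R}\{1,i\}$; $\langle\cdot,\cdot\rangle$ is the Euclidean inner product on $\mathbb C\cong\mathbb R^2$. $\Gamma\subset\mathbb C$ a lattice, $T^2=\mathbb C/\Gamma$, $\Gamma^*$ its dual lattice. A Hamiltonian stationary torus is a $\Gamma$-periodic conformal immersion $f:\mathbb C\to\mathbb H$ with $df=e^{j\beta/2}dz\,g$, $dz=dx+i\,dy$, $g$ nowhere zero, $\beta(z)=2\pi\langle\beta_0,z\rangle$, $0\ne\beta_0\in\Gamma^*$; convention $*dz=i\,dz$; left normal $N=e^{j\beta}i$. $\alpha$ is holomorphic if $*d\alpha=N\,d\alpha$. With $(dN)'=\frac12(dN-N*dN)=-df\,H$, set $d^\mu\alpha=d\alpha+\frac12df\,H\,(N\alpha(a-1)+\alpha b)$, $a=\frac{\mu+\mu^{-1}}2$, $b=\frac{\mu^{-1}-\mu}2i$ (right multiplication), $\mu\in\mathbb C_*$; $d^\mu$-parallel sections are holomorphic. With $h^{A,B}(\gamma)=e^{2\pi(\langle A,\gamma\rangle-i\langle B,\gamma\rangle)}$, $\Gamma^*_{A,B}=\{\delta\in\Gamma^*+\frac{\beta_0}2:|\delta-B|^2-|A|^2=\frac{|\beta_0|^2}4,\ \langle\delta-B,A\rangle=0\}$, $e_\delta(z)=e^{2\pi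 i\langle\delta,z\rangle}$, $\lambda_\delta=\frac2{\beta_0}(\delta-iA-B)$, a monochromatic holomorphic section is a nonzero complex multiple of $e^{j\beta/2}(1-k\lambda_\delta)e_{\delta-B}e^{2\pi\langle A,\cdot\rangle}$, $\delta\in\Gamma^*_{A,B}$. Darboux transform given by a nowhere vanishing holomorphic $\alpha$ with multiplier ($\alpha(z+\gamma)=\alpha(z)h(\gamma)$, $h:\Gamma\to\mathbb C_*$): define $\hat T$ by $d\alpha=-df\,\hat T\alpha$, $\nu=\hat T\alpha$, $\hat f=\begin{pmatrix}f\nu+\alpha\\ \nu\end{pmatrix}\mathbb H$ ($=f+\hat T^{-1}$ where $\hat T\ne0$). It is monochromatic if $\alpha$ is monochromatic, and a $\mu$--Darboux transform if $d^\mu\alpha=0$; it is closed if it is defined on $T^2$, i.e. $\alpha$ has a multiplier on $\Gamma$. *)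

(* Defs.v *)
(* R : realType.  Quaternions are modelled
   concretely as 4-tuples of reals with the Hamilton product;
   C = span{1,i} inside H; points of C = R^2 are pairs (x,y), z = x + i y. *)
From HB Require Import structures.
From mathcomp Require Import all_boot all_order all_algebra.
From mathcomp Require Import all_classical all_reals all_analysis.
Set Implicit Arguments. Unset Strict Implicit. Unset Printing Implicit Defensive.
Import Order.TTheory GRing.Theory Num.Theory numFieldNormedType.Exports.
Local Open Scope ring_scope.

Section Defs.
Variable R : realType.

Record quat := Quat { q0 : R; q1 : R; q2 : R; q3 : R }.

Definition qzero : quat := Quat 0 0 0 0.
Definition qreal (r : R) : quat := Quat r 0 0 0.
Definition qone : quat := qreal 1.
Definition qI : quat := Quat 0 1 0 0.
Definition qJ : quat := Quat 0 0 1 0.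
Definition qK : quat := Quat 0 0 0 1.
Definition qadd (p q : quat) : quat :=
  Quat (q0 p + q0 q) (q1 p + q1 q) (q2 p + q2 q) (q3 p + q3 q).
Definition qopp (p : quat) : quat := Quat (- q0 p) (- q1 p) (- q2 p) (- q3 p).
Definition qsub (p q : quat) : quat := qadd p (qopp q).
Definition qscale (r : R) (p : quat) : quat :=
  Quat (r * q0 p) (r * q1 p) (r * q2 p) (r * q3 p).
Definition qmul (p q : quat) : quat :=
  Quat (q0 p * q0 q - q1 p * q1 q - q2 p * q2 q - q3 p * q3 q)
       (q0 p * q1 q + q1 p * q0 q + q2 p * q3 q - q3 p * q2 q)
       (q0 p * q2 q - q1 p * q3 q + q2 p * q0 q + q3 p * q1 q)
       (q0 p * q3 q + q1 p * q2 q - q2 p * q1 q + q3 p * q0 q).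
Definition qnorm2 (p : quat) : R :=
  q0 p ^+ 2 + q1 p ^+ 2 + q2 p ^+ 2 + q3 p ^+ 2.
Definition qinv (p : quat) : quat :=
  let n := qnorm2 p in Quat (q0 p / n) (- q1 p / n) (- q2 p / n) (- q3 p / n).

Definition is_cplx (q : quat) : Prop := q2 q = 0 /\ q3 q = 0.
Definition ptC (u : R * R) : quat := Quat u.1 u.2 0 0.
Definition expj (t : R) : quat := Quat (cos t) 0 (sin t) 0.
Definition expi (t : R) : quat := Quat (cos t) (sin t) 0 0.

Definition padd (u v : R * R) : R * R := (u.1 + v.1, u.2 + v.2).
Definition psub (u v : R * R) : R * R := (u.1 - v.1, u.2 - v.2).
Definition pscale (r : R) (u : R * R) : R * R := (r * u.1, r * u.2).
Definition dot (u v : R * R) : R := u.1 * v.1 + u.2 * v.2.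

Definition lattice_basis (w1 w2 : R * R) : Prop := w1.1 * w2.2 - w1.2 * w2.1 != 0.
Definition in_lattice (w1 w2 : R * R) (g : R * R) : Prop :=
  exists m n : int, g = padd (pscale m%:~R w1) (pscale n%:~R w2).
Definition in_dual (w1 w2 : R * R) (d : R * R) : Prop :=
  forall g, in_lattice w1 w2 g -> exists k : int, dot d g = k%:~R.

Definition pdx (F : R * R -> R) (p : R * R) : R := derive1 (fun t => F (t, p.2)) p.1.
Definition pdy (F : R * R -> R) (p : R * R) : R := derive1 (fun t => F (p.1, t)) p.2.
Definition pd (b : bool) F := if b then pdx F else pdy F.
Fixpoint iterpd (s : seq bool) (F : R * R -> R) : R * R -> R :=
  if s is b :: s' then pd b (iterpd s' F) else F.
Definition smoothR (F : R * R -> R) : Prop :=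
  forall s : seq bool, continuous (iterpd s F : (R * R)%type -> R) /\
    forall p : R * R, derivable (fun t => iterpd s F (t, p.2)) p.1 1 /\
                      derivable (fun t => iterpd s F (p.1, t)) p.2 1.
Definition smoothQ (F : R * R -> quat) : Prop :=
  [/\ smoothR (fun z => q0 (F z)), smoothR (fun z => q1 (F z)),
      smoothR (fun z => q2 (F z)) & smoothR (fun z => q3 (F z))].
Definition qpdx (F : R * R -> quat) (p : R * R) : quat :=
  Quat (pdx (fun z => q0 (F z)) p) (pdx (fun z => q1 (F z)) p)
       (pdx (fun z => q2 (F z)) p) (pdx (fun z => q3 (F z)) p).
Definition qpdy (F : R * R -> quat) (p : R * R) : quat :=
  Quat (pdy (fun z => q0 (F z)) p) (pdy (fun z => q1 (F z)) p)
       (pdy (fun z => q2 (F z)) p) (pdy (fun z => q3 (F z)) p).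

Definition beta (b0 : R * R) (z : R * R) : R := 2 * pi * dot b0 z.

(* f : C -> H is a Gamma-periodic conformal immersion with
   df = e^{j beta/2} dz g, g nowhere zero, dz = dx + i dy, i.e.
   f_x = e^{j beta/2} g  and  f_y = e^{j beta/2} i g. *)
Definition ham_stationary_torus (w1 w2 b0 : R * R) (f : R * R -> quat) : Prop :=
  [/\ (lattice_basis w1 w2 /\ b0 != (0, 0)), in_dual w1 w2 b0, smoothQ f,
      (forall g z, in_lattice w1 w2 g -> f (padd z g) = f z) &
      exists g : R * R -> quat, forall z, g z <> qzero /\
         qpdx f z = qmul (expj (beta b0 z / 2)) (g z) /\
         qpdy f z = qmul (expj (beta b0 z / 2)) (qmul qI (g z))].

Definition normalN (b0 : R * R) (z : R * R) : quat := qmul (expj (beta b0 z)) qI.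

(* mean curvature H defined by (dN)' = 1/2 (dN - N * dN) = - df H,
   evaluated on d/dx:  1/2 (N_x - N N_y) = - f_x H  (here *omega(X) = omega(JX)) *)
Definition Hmean (b0 : R * R) (f : R * R -> quat) (z : R * R) : quat :=
  qopp (qmul (qinv (qpdx f z))
    (qscale (1/2) (qsub (qpdx (normalN b0) z)
                        (qmul (normalN b0 z) (qpdy (normalN b0) z))))).

(* holomorphic: *d alpha = N d alpha, with *d alpha (X) = d alpha (J X):
   on d/dx: alpha_y = N alpha_x ; on d/dy: - alpha_x = N alpha_y *)
Definition holomorphic (b0 : R * R) (alpha : R * R -> quat) : Prop :=
  forall z, qpdy alpha z = qmul (normalN b0 z) (qpdx alpha z) /\
            qopp (qpdx alpha z) = qmul (normalN b0 z) (qpdy alpha z).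

Definition mu_a (mu : quat) : quat := qscale (1/2) (qadd mu (qinv mu)).
Definition mu_b (mu : quat) : quat := qmul (qscale (1/2) (qsub (qinv mu) mu)) qI.

Definition dmu_tail (b0 : R * R) (f : R * R -> quat) (mu : quat)
    (alpha : R * R -> quat) (z : R * R) : quat :=
  qscale (1/2) (qmul (Hmean b0 f z)
    (qadd (qmul (qmul (normalN b0 z) (alpha z)) (qsub (mu_a mu) qone))
          (qmul (alpha z) (mu_b mu)))).

Definition dmu_parallel (b0 : R * R) (f : R * R -> quat) (mu : quat)
    (alpha : R * R -> quat) : Prop :=
  forall z, qadd (qpdx alpha z) (qmul (qpdx f z) (dmu_tail b0 f mu alpha z)) = qzero /\
            qadd (qpdy alpha z) (qmul (qpdy f z) (dmu_tail b0 f mu alpha z)) = qzero.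

Definition has_multiplier (w1 w2 : R * R) (alpha : R * R -> quat) : Prop :=
  exists h : R * R -> quat, forall g, in_lattice w1 w2 g ->
    [/\ is_cplx (h g), h g <> qzero &
        forall z, alpha (padd z g) = qmul (alpha z) (h g)].

Definition same_line (u v : quat * quat) : Prop :=
  exists q, q <> qzero /\ u.1 = qmul v.1 q /\ u.2 = qmul v.2 q.

(* fhat is (represented by homogeneous coordinates of) the Darboux
   transform of f given by alpha: alpha smooth, nowhere vanishing and
   holomorphic, d alpha = - df That alpha, nu = That alpha,
   fhat = (f nu + alpha, nu) H  in HP^1. *)
Definition darboux_transform (b0 : R * R) (f : R * R -> quat)
    (alpha : R * R -> quat) (fhat : R * R -> quat * quat) : Prop :=
  [/\ smoothQ alpha, (forall z, alpha z <> qzero), holomorphic b0 alpha &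
      exists That : R * R -> quat,
        (forall z, qpdx alpha z = qopp (qmul (qmul (qpdx f z) (That z)) (alpha z))) /\
        (forall z, qpdy alpha z = qopp (qmul (qmul (qpdy f z) (That z)) (alpha z))) /\
        (forall z, let nu := qmul (That z) (alpha z) in
                   same_line (fhat z) (qadd (qmul (f z) nu) (alpha z), nu))].

Definition closed_mu_darboux (w1 w2 b0 : R * R) (f : R * R -> quat)
    (fhat : R * R -> quat * quat) : Prop :=
  exists (mu : quat) (alpha : R * R -> quat),
    [/\ is_cplx mu, mu <> qzero, dmu_parallel b0 f mu alpha,
        has_multiplier w1 w2 alpha & darboux_transform b0 f alpha fhat].

Definition in_GammaAB (w1 w2 b0 A B d : R * R) : Prop :=
  [/\ in_dual w1 w2 (psub d (pscale (1/2) b0)),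
      dot (psub d B) (psub d B) - dot A A = dot b0 b0 / 4 &
      dot (psub d B) A = 0].

Definition lambda_d (b0 A B d : R * R) : quat :=
  qmul (qscale 2 (qinv (ptC b0)))
       (qsub (qsub (ptC d) (qmul qI (ptC A))) (ptC B)).

Definition monochromatic (w1 w2 b0 : R * R) (alpha : R * R -> quat) : Prop :=
  exists (A B d : R * R) (c : quat),
    [/\ in_GammaAB w1 w2 b0 A B d, is_cplx c, c <> qzero &
        forall z, alpha z =
          qmul (qmul (qmul (qmul (expj (beta b0 z / 2))
                                 (qsub qone (qmul qK (lambda_d b0 A B d))))
                           (expi (2 * pi * dot (psub d B) z)))
                     (qreal (expR (2 * pi * dot A z))))
               c].

Definition mono_darboux (w1 w2 b0 : R * R) (f : R * R -> quat)
    (fhat : R * R -> quat * quat) : Prop :=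
  exists alpha : R * R -> quat,
    monochromatic w1 w2 b0 alpha /\ darboux_transform b0 f alpha fhat.

End Defs.

(* Main.v *)
(* Write alpha = e^{j beta/2} phi. As H contains the factor (f_x)^-1, the
   immersion cancels and d^mu alpha = 0 becomes a linear system for phi with
   constant coefficients that commute with right multiplication by C. For
   mu = lam^-2 its joint eigensections are (1 - k lam) e^E and
   (1 + k lam) e^{-E}, with E linear in z, so every parallel alpha is
   e^{j beta/2} ((1 - k lam) e^E c1 + (1 + k lam) e^{-E} c2). If c1 or c2 is 0,
   alpha is monochromatic. Otherwise the multiplier forces |e^E| = |e^{-E}| on
   the lattice, so E is imaginary and |lam| = 1; right multiplication by j then
   exchanges the two eigenlines, and alpha = alpha' q with alpha' monochromatic
   and q a quaternion. Since d alpha = - df T alpha determines the same T for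
   alpha and alpha', both give the same transform. *)
Require Import Defs.
From mathcomp Require Import all_boot all_order all_algebra.
From mathcomp Require Import all_classical all_reals all_analysis.
From mathcomp Require Import ring lra.
From mathcomp Require complex.
Set Implicit Arguments. Unset Strict Implicit. Unset Printing Implicit Defensive.
Import Order.TTheory GRing.Theory Num.Theory numFieldNormedType.Exports.
Local Open Scope ring_scope.

(** * Quaternion algebra and the exponentials [expi] and [expj] *)

Lemma quat_eq (R : realType) (p q : quat R) :
  q0 p = q0 q -> q1 p = q1 q -> q2 p = q2 q -> q3 p = q3 q -> p = q.
Proof. by case: p q => ???? [????] /= -> -> -> ->. Qed.

Ltac qring := apply: quat_eq => /=; ring.

Section Quaternions.
Variable R : realType.
Implicit Types (p q r : quat R) (s t : R).

Lemma qmulA p q r : qmul p (qmul q r) = qmul (qmul p q) r.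
Proof. qring. Qed.

Lemma qmul1q p : qmul (qone R) p = p.
Proof. qring. Qed.

Lemma qmulq1 p : qmul p (qone R) = p.
Proof. qring. Qed.

Lemma qmul0q p : qmul (qzero R) p = qzero R.
Proof. qring. Qed.

Lemma qmulq0 p : qmul p (qzero R) = qzero R.
Proof. qring. Qed.

Lemma qmulDl p q r : qmul (qadd p q) r = qadd (qmul p r) (qmul q r).
Proof. qring. Qed.

Lemma qmulDr p q r : qmul p (qadd q r) = qadd (qmul p q) (qmul p r).
Proof. qring. Qed.

Lemma qmul_cplxC p q : is_cplx p -> is_cplx q -> qmul p q = qmul q p.
Proof.
by move=> [p2 p3] [r2 r3]; apply: quat_eq => /=; rewrite p2 p3 r2 r3; ring.
Qed.

Lemma is_cplx_mul p q : is_cplx p -> is_cplx q -> is_cplx (qmul p q).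
Proof. by move=> [p2 p3] [r2 r3]; split => /=; rewrite p2 p3 r2 r3; ring. Qed.

Lemma is_cplx_opp p : is_cplx p -> is_cplx (qopp p).
Proof. by move=> [p2 p3]; split; rewrite /= ?p2 ?p3 oppr0. Qed.

Lemma qmulNN p q : qmul (qopp p) (qopp q) = qmul p q.
Proof. qring. Qed.

Lemma qnorm2_eq0 p : qnorm2 p = 0 -> p = qzero R.
Proof.
rewrite /qnorm2 => p0; apply: quat_eq => /=; apply/eqP; rewrite -sqrf_eq0;
  apply/eqP; have := (sqr_ge0 (q0 p), sqr_ge0 (q1 p), sqr_ge0 (q2 p), sqr_ge0 (q3 p));
  by move=> [[[? ?] ?] ?]; lra.
Qed.

Lemma qnorm2M p q : qnorm2 (qmul p q) = qnorm2 p * qnorm2 q.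
Proof. by rewrite /qnorm2 /=; ring. Qed.

Lemma qnorm2_neq0 p : p <> qzero R -> qnorm2 p != 0.
Proof. by move=> p0; apply/eqP => /qnorm2_eq0. Qed.

Lemma qmulqV p : p <> qzero R -> qmul p (qinv p) = qone R.
Proof.
move=> /qnorm2_neq0; rewrite /qnorm2 => p0.
by apply: quat_eq; rewrite /= /qnorm2; field.
Qed.

Lemma qmulVq p : p <> qzero R -> qmul (qinv p) p = qone R.
Proof.
move=> /qnorm2_neq0; rewrite /qnorm2 => p0.
by apply: quat_eq; rewrite /= /qnorm2; field.
Qed.

Lemma qmul_neq0 p q : p <> qzero R -> q <> qzero R -> qmul p q <> qzero R.
Proof.
move=> p0 nq0 pq0; apply: nq0.
by rewrite -(qmul1q q) -(qmulVq p0) -qmulA pq0 qmulq0.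
Qed.

Lemma qmul_eq1_neq0 p q : qmul p q = qone R -> p <> qzero R /\ q <> qzero R.
Proof.
move=> pq1; split=> z0; move: pq1; rewrite z0 ?qmul0q ?qmulq0 => -[] /esym/eqP;
  by rewrite oner_eq0.
Qed.

Lemma qinv_neq0 p : p <> qzero R -> qinv p <> qzero R.
Proof. by move=> /qmulqV/qmul_eq1_neq0[]. Qed.

Lemma qinv_unique p q : qmul p q = qone R -> qinv p = q.
Proof.
move=> pq1; have [p0 _] := qmul_eq1_neq0 pq1.
by rewrite -(qmulq1 (qinv p)) -pq1 qmulA qmulVq // qmul1q.
Qed.

Lemma qmulI p q r : p <> qzero R -> qmul p q = qmul p r -> q = r.
Proof.
by move=> p0 e; rewrite -(qmul1q q) -(qmulVq p0) -qmulA e qmulA qmulVq // qmul1q.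
Qed.

Lemma qmulIr p q r : r <> qzero R -> qmul p r = qmul q r -> p = q.
Proof.
by move=> r0 e; rewrite -(qmulq1 p) -(qmulqV r0) qmulA e -qmulA qmulqV // qmulq1.
Qed.

Lemma expjD s t : expj (s + t) = qmul (expj s) (expj t).
Proof. by rewrite /expj cosD sinD; qring. Qed.

Lemma expiD s t : expi (s + t) = qmul (expi s) (expi t).
Proof. by rewrite /expi cosD sinD; qring. Qed.

Lemma qnorm2_expj t : qnorm2 (expj t) = 1.
Proof. by rewrite /qnorm2 /= -(cos2Dsin2 t); ring. Qed.

Lemma qnorm2_expi t : qnorm2 (expi t) = 1.
Proof. by rewrite /qnorm2 /= -(cos2Dsin2 t); ring. Qed.

Lemma qnorm2_neq0P p : qnorm2 p != 0 -> p <> qzero R.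
Proof. by move=> /eqP p0 pz; apply: p0; rewrite pz /qnorm2 /=; ring. Qed.

Lemma expj_neq0 t : expj t <> qzero R.
Proof. by apply: qnorm2_neq0P; rewrite qnorm2_expj oner_eq0. Qed.

Lemma sin_intpi (k : int) : sin (pi * k%:~R) = 0 :> R.
Proof.
have sinn (n : nat) : sin (pi * n%:R) = 0 :> R.
  elim: n => [|n ih]; first by rewrite mulr0 sin0.
  by rewrite -natr1 mulrDr mulr1 sinDpi ih oppr0.
case: k => n; first exact: sinn.
by rewrite NegzE mulrNz mulrN sinN sinn oppr0.
Qed.

Lemma cos_intpi_neq0 (k : int) : cos (pi * k%:~R) != 0 :> R.
Proof.
apply/eqP => c0; have := cos2Dsin2 (pi * k%:~R : R).
by rewrite c0 sin_intpi expr0n /= addr0 => /esym/eqP; rewrite oner_eq0.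
Qed.

End Quaternions.

(** * Calculus of quaternion-valued functions *)

Section Derivatives.
Variable R : realType.
Implicit Types (F G : R -> quat R) (c D E : quat R) (t a : R).

(** A relation rather than a total operator, so that differentiability travels with the value and
    the product rule applies without side conditions. *)
Definition qder F t D : Prop :=
  [/\ is_derive t 1 (fun s => q0 (F s)) (q0 D),
      is_derive t 1 (fun s => q1 (F s)) (q1 D),
      is_derive t 1 (fun s => q2 (F s)) (q2 D) &
      is_derive t 1 (fun s => q3 (F s)) (q3 D)].

Lemma is_derive_congr (u : R -> R) t (u' v' : R) :
  is_derive t 1 u u' -> u' = v' -> is_derive t 1 u v'.
Proof. by move=> + <-. Qed.

Lemma is_derive_mul (u v : R -> R) t (u' v' : R) :
  is_derive t 1 u u' -> is_derive t 1 v v' ->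
  is_derive t 1 (fun s => u s * v s) (u' * v t + u t * v').
Proof.
move=> du dv; apply: is_derive_congr (is_deriveM du dv) _.
by rewrite /GRing.scale /=; ring.
Qed.

Lemma is_derive_add (u v : R -> R) t (u' v' : R) :
  is_derive t 1 u u' -> is_derive t 1 v v' ->
  is_derive t 1 (fun s => u s + v s) (u' + v').
Proof. by move=> du dv; exact: is_deriveD. Qed.

Lemma is_derive_sub (u v : R -> R) t (u' v' : R) :
  is_derive t 1 u u' -> is_derive t 1 v v' ->
  is_derive t 1 (fun s => u s - v s) (u' - v').
Proof. by move=> du dv; exact: is_deriveB. Qed.

Lemma qder_eq F t D E : qder F t D -> D = E -> qder F t E.
Proof. by move=> dF <-. Qed.

Lemma qder_cst c t : qder (fun=> c) t (qzero R).
Proof. by split; exact: is_derive_cst. Qed.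

Lemma qderD F G t D E : qder F t D -> qder G t E ->
  qder (fun s => qadd (F s) (G s)) t (qadd D E).
Proof. by move=> [????] [????]; split; exact: is_derive_add. Qed.

Lemma qderM F G t D E : qder F t D -> qder G t E ->
  qder (fun s => qmul (F s) (G s)) t (qadd (qmul D (G t)) (qmul (F t) E)).
Proof.
move=> [d0 d1 d2 d3] [e0 e1 e2 e3]; have M := is_derive_mul.
split.
- apply: is_derive_congr (is_derive_sub (is_derive_sub (is_derive_sub
    (M _ _ _ _ _ d0 e0) (M _ _ _ _ _ d1 e1)) (M _ _ _ _ _ d2 e2)) (M _ _ _ _ _ d3 e3)) _.
  by rewrite /=; ring.
- apply: is_derive_congr (is_derive_sub (is_derive_add (is_derive_add
    (M _ _ _ _ _ d0 e1) (M _ _ _ _ _ d1 e0)) (M _ _ _ _ _ d2 e3)) (M _ _ _ _ _ d3 e2)) _.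
  by rewrite /=; ring.
- apply: is_derive_congr (is_derive_add (is_derive_add (is_derive_sub
    (M _ _ _ _ _ d0 e2) (M _ _ _ _ _ d1 e3)) (M _ _ _ _ _ d2 e0)) (M _ _ _ _ _ d3 e1)) _.
  by rewrite /=; ring.
- apply: is_derive_congr (is_derive_add (is_derive_sub (is_derive_add
    (M _ _ _ _ _ d0 e3) (M _ _ _ _ _ d1 e2)) (M _ _ _ _ _ d2 e1)) (M _ _ _ _ _ d3 e0)) _.
  by rewrite /=; ring.
Qed.

Lemma qderMl c F t D : qder F t D -> qder (fun s => qmul c (F s)) t (qmul c D).
Proof.
move=> dF; apply: qder_eq (qderM (qder_cst c t) dF) _. qring.
Qed.

Lemma qderMr c F t D : qder F t D -> qder (fun s => qmul (F s) c) t (qmul D c).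
Proof.
move=> dF; apply: qder_eq (qderM dF (qder_cst c t)) _; qring.
Qed.

Lemma is_derive_affine (a b t : R) : is_derive t 1 (fun s => a * s + b) a.
Proof.
apply: is_derive_congr (is_derive_add (is_derive_mul (is_derive_cst a t 1)
  (is_derive_id t 1)) (is_derive_cst b t 1)) _.
rewrite /=; ring.
Qed.

Lemma is_derive_comp_affine (u : R -> R) (u' a b t : R) :
  is_derive (a * t + b) 1 u u' -> is_derive t 1 (fun s => u (a * s + b)) (a * u').
Proof.
move=> du; apply: is_derive_congr 
  (@is_derive1_comp _ u (fun s => a * s + b) t _ _ du (is_derive_affine a b t)) _.
by rewrite mulrC.
Qed.

Lemma qder_expj a b t :
  qder (fun s => expj (a * s + b)) t (qmul (qscale a (qJ R)) (expj (a * t + b))).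
Proof.
split; [apply: is_derive_congr (is_derive_comp_affine (is_derive_cos _)) _
  | apply: is_derive_congr (is_derive_cst _ _ _) _
  | apply: is_derive_congr (is_derive_comp_affine (is_derive_sin _)) _
  | apply: is_derive_congr (is_derive_cst _ _ _) _]; rewrite /=; ring.
Qed.

Lemma qder_expi a b t :
  qder (fun s => expi (a * s + b)) t (qmul (qscale a (qI R)) (expi (a * t + b))).
Proof.
split; [apply: is_derive_congr (is_derive_comp_affine (is_derive_cos _)) _
  | apply: is_derive_congr (is_derive_comp_affine (is_derive_sin _)) _
  | apply: is_derive_congr (is_derive_cst _ _ _) _
  | apply: is_derive_congr (is_derive_cst _ _ _) _]; rewrite /=; ring.
Qed.

Lemma qder_expR a b t :
  qder (fun s => qreal (expR (a * s + b))) t (qscale a (qreal (expR (a * t + b)))).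
Proof.
split; [apply: is_derive_congr (is_derive_comp_affine (is_derive_expR _)) _
  | apply: is_derive_congr (is_derive_cst _ _ _) _
  | apply: is_derive_congr (is_derive_cst _ _ _) _
  | apply: is_derive_congr (is_derive_cst _ _ _) _]; rewrite /=; ring.
Qed.

Lemma qder0_cst F : (forall t, qder F t (qzero R)) -> forall s t, F s = F t.
Proof.
move=> dF s t; apply: quat_eq.
- by apply: (@is_derive_0_is_cst _ (fun s => q0 (F s))) => x; case: (dF x).
- by apply: (@is_derive_0_is_cst _ (fun s => q1 (F s))) => x; case: (dF x).
- by apply: (@is_derive_0_is_cst _ (fun s => q2 (F s))) => x; case: (dF x).
- by apply: (@is_derive_0_is_cst _ (fun s => q3 (F s))) => x; case: (dF x).
Qed.

Definition qderx (F : R * R -> quat R) z D := qder (fun t => F (t, z.2)) z.1 D.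
Definition qdery (F : R * R -> quat R) z D := qder (fun t => F (z.1, t)) z.2 D.

Lemma qderx_pdx (F : R * R -> quat R) z D : qderx F z D -> qpdx F z = D.
Proof.
by case=> d0 d1 d2 d3; apply: quat_eq => /=; rewrite /pdx derive1E; exact: derive_val.
Qed.

Lemma qdery_pdy (F : R * R -> quat R) z D : qdery F z D -> qpdy F z = D.
Proof.
by case=> d0 d1 d2 d3; apply: quat_eq => /=; rewrite /pdy derive1E; exact: derive_val.
Qed.

Lemma smooth_qderx (F : R * R -> quat R) z : smoothQ F -> qderx F z (qpdx F z).
Proof.
case=> s0 s1 s2 s3; split; rewrite /= /pdx derive1E; apply: derivableP.
- exact: ((s0 [::]).2 z).1.
- exact: ((s1 [::]).2 z).1.
- exact: ((s2 [::]).2 z).1.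
- exact: ((s3 [::]).2 z).1.
Qed.

Lemma smooth_qdery (F : R * R -> quat R) z : smoothQ F -> qdery F z (qpdy F z).
Proof.
case=> s0 s1 s2 s3; split; rewrite /= /pdy derive1E; apply: derivableP.
- exact: ((s0 [::]).2 z).2.
- exact: ((s1 [::]).2 z).2.
- exact: ((s2 [::]).2 z).2.
- exact: ((s3 [::]).2 z).2.
Qed.

(** A horizontal and then a vertical segment lead to the origin, so the one-variable case applies
    twice. *)
Lemma qder0_cst2 (F : R * R -> quat R) :
  (forall z, qderx F z (qzero R)) -> (forall z, qdery F z (qzero R)) ->
  forall z, F z = F (0, 0).
Proof.
move=> dx dy [x y].
have -> : F (x, y) = F (0, y).
  by apply: (@qder0_cst (fun t => F (t, y))) => t; exact: (dx (t, y)).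
by apply: (@qder0_cst (fun t => F (0, t))) => t; exact: (dy (0, t)).
Qed.

(** Needed for right multiplication by a constant quaternion, whose components are real linear
    combinations of the four components of [F]. *)
Lemma smoothR_lin (F G : R * R -> R) (a b : R) : smoothR F -> smoothR G ->
  smoothR (fun z => a * F z + b * G z).
Proof.
move=> sF sG.
have lin u v (t : R) : derivable u t 1 -> derivable v t 1 ->
    is_derive t 1 (fun x => a * u x + b * v x) (a * 'D_1 u t + b * 'D_1 v t).
  move=> du dv; apply: is_derive_congr (is_derive_add
    (is_derive_mul (is_derive_cst a t 1) (derivableP du))
    (is_derive_mul (is_derive_cst b t 1) (derivableP dv))) _.
  by rewrite /=; ring.
(* An equality of functions, so that the induction can differentiate it once more. *)
have iterE s : iterpd s (fun z => a * F z + b * G z) =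
               (fun z => a * iterpd s F z + b * iterpd s G z).
  elim: s => [//|c s ih] /=; rewrite ih; apply/funext => z.
  have [_ /(_ z) [Fx Fy]] := sF s; have [_ /(_ z) [Gx Gy]] := sG s.
  case: c; rewrite /= ?/pdx ?/pdy !derive1E.
  - exact: (@derive_val _ _ _ _ _ _ _ (lin _ _ _ Fx Gx)).
  - exact: (@derive_val _ _ _ _ _ _ _ (lin _ _ _ Fy Gy)).
move=> s; rewrite iterE; have [cF dF] := sF s; have [cG dG] := sG s; split.
  move=> z; apply: (@continuousD _ _ _ (fun z => a * iterpd s F z)).
    by apply: continuousM; [exact: cst_continuous | exact: cF].
  by apply: continuousM; [exact: cst_continuous | exact: cG].
move=> z; have [Fx Fy] := dF z; have [Gx Gy] := dG z; split.
- exact: (@ex_derive _ _ _ _ _ _ _ (lin _ _ _ Fx Gx)).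
- exact: (@ex_derive _ _ _ _ _ _ _ (lin _ _ _ Fy Gy)).
Qed.

Lemma smoothQ_mulr (F : R * R -> quat R) c :
  smoothQ F -> smoothQ (fun z => qmul (F z) c).
Proof.
case=> s0 s1 s2 s3.
have comb a0 a1 a2 a3 : smoothR (fun z => 1 * (a0 * q0 (F z) + a1 * q1 (F z)) +
    1 * (a2 * q2 (F z) + a3 * q3 (F z))).
  by apply: smoothR_lin; apply: smoothR_lin.
have eqS (u v : R * R -> R) : smoothR u -> u = v -> smoothR v by move=> ? <-.
split; [apply: eqS (comb (q0 c) (- q1 c) (- q2 c) (- q3 c)) _
  | apply: eqS (comb (q1 c) (q0 c) (q3 c) (- q2 c)) _
  | apply: eqS (comb (q2 c) (- q3 c) (q0 c) (q1 c)) _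
  | apply: eqS (comb (q3 c) (q2 c) (- q1 c) (q0 c)) _];
  by apply/funext => z /=; ring.
Qed.

End Derivatives.

(** * The gauge alpha = e^{j beta/2} phi and its constant-coefficient system *)

Section Gauge.
Variable R : realType.
Implicit Types (z g u A : R * R) (p q mu lam r phi D : quat R).

(** Two orders of the summands: each puts one coordinate first, to match the shape a * s + b in
    [qder_expj]. *)
Lemma beta_halfE (b0 : R * R) z :
  (beta b0 z / 2 = pi * b0.1 * z.1 + pi * b0.2 * z.2) *
  (beta b0 z / 2 = pi * b0.2 * z.2 + pi * b0.1 * z.1).
Proof. by split; rewrite /beta /dot; field. Qed.

Lemma gauge_derx (b0 : R * R) (F : R * R -> quat R) z D : qderx F z D ->
  qderx (fun z => qmul (expj (beta b0 z / 2)) (F z)) z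
    (qmul (expj (beta b0 z / 2)) (qadd D (qscale (pi * b0.1) (qmul (qJ R) (F z))))).
Proof.
move=> dF; have := qderM (qder_expj (pi * b0.1) (pi * b0.2 * z.2) z.1) dF.
rewrite /qderx; under eq_fun do rewrite -(beta_halfE b0 (_, z.2)).1.
rewrite -(beta_halfE b0 z).1 => /qder_eq; apply; rewrite -surjective_pairing.
by qring.
Qed.

Lemma gauge_dery (b0 : R * R) (F : R * R -> quat R) z D : qdery F z D ->
  qdery (fun z => qmul (expj (beta b0 z / 2)) (F z)) z
    (qmul (expj (beta b0 z / 2)) (qadd D (qscale (pi * b0.2) (qmul (qJ R) (F z))))).
Proof.
move=> dF; have := qderM (qder_expj (pi * b0.2) (pi * b0.1 * z.1) z.2) dF.
rewrite /qdery; under eq_fun do rewrite -(beta_halfE b0 (z.1, _)).2.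
rewrite -(beta_halfE b0 z).2 => /qder_eq; apply; rewrite -surjective_pairing.
by qring.
Qed.

Lemma beta_double (b0 : R * R) z : beta b0 z = beta b0 z / 2 + beta b0 z / 2.
Proof. by field. Qed.

(** Since i e^{jt} = e^{-jt} i, half of the rotation in N = e^{j beta} i is undone: inside the
    gauge, N acts as left multiplication by i. *)
Lemma normalN_gauge (b0 : R * R) z :
  qmul (normalN b0 z) (expj (beta b0 z / 2)) = qmul (expj (beta b0 z / 2)) (qI R).
Proof.
rewrite /normalN {1}beta_double expjD -!qmulA; congr qmul.
rewrite /expj; set t := beta b0 z / 2; have e := sin2cos2 t.
by apply: quat_eq => /=; ring: e.
Qed.

Lemma normalN_derx (b0 : R * R) z : qpdx (normalN b0) z =
  qscale (2 * pi * b0.1) (qmul (qJ R) (normalN b0 z)).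
Proof.
apply: qderx_pdx; rewrite /qderx.
have E t : beta b0 (t, z.2) = 2 * pi * b0.1 * t + 2 * pi * b0.2 * z.2.
  by rewrite /beta /dot /=; ring.
under eq_fun do rewrite /normalN E; have := E z.1; rewrite -surjective_pairing /normalN => ->.
by apply: qder_eq (qderMr (qI R) (qder_expj _ _ _)) _; qring.
Qed.

Lemma normalN_dery (b0 : R * R) z : qpdy (normalN b0) z =
  qscale (2 * pi * b0.2) (qmul (qJ R) (normalN b0 z)).
Proof.
apply: qdery_pdy; rewrite /qdery.
have E t : beta b0 (z.1, t) = 2 * pi * b0.2 * t + 2 * pi * b0.1 * z.1.
  by rewrite /beta /dot /=; ring.
under eq_fun do rewrite /normalN E; have := E z.2; rewrite -surjective_pairing /normalN => ->.
by apply: qder_eq (qderMr (qI R) (qder_expj _ _ _)) _; qring.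
Qed.

(** Differentiating N brings out 2 pi j N with real coefficients b0.1 and b0.2. Inside the gauge N
    is i, and i j i = j merges both terms into j i b0. *)
Lemma curvature_gauge (b0 : R * R) z p :
  qmul (qsub (qpdx (normalN b0) z) (qmul (normalN b0 z) (qpdy (normalN b0) z)))
       (qmul (expj (beta b0 z / 2)) p) =
  qmul (expj (beta b0 z / 2))
       (qscale (2 * pi) (qmul (qJ R) (qmul (qI R) (qmul (ptC b0) p)))).
Proof.
set w := expj _; rewrite normalN_derx normalN_dery.
have := normalN_gauge b0 z; rewrite -/w; move: (normalN b0 z) => N Nw.
have Jw : qmul (qJ R) w = qmul w (qJ R) by rewrite /w /expj; qring.
have -> : qmul (qsub (qscale (2 * pi * b0.1) (qmul (qJ R) N))
    (qmul N (qscale (2 * pi * b0.2) (qmul (qJ R) N))))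
    (qmul w p) =
  qsub (qscale (2 * pi * b0.1) (qmul (qJ R) (qmul (qmul N w) p)))
   (qscale (2 * pi * b0.2)
     (qmul N (qmul (qJ R) (qmul (qmul N w) p)))).
  by qring.
rewrite Nw -!qmulA (qmulA (qJ R)) Jw -!qmulA (qmulA N) Nw.
by qring.
Qed.

(** The bracket N alpha (a - 1) + alpha b of d^mu, with N replaced by i. *)
Definition dmu_coeff mu phi : quat R :=
  qadd (qmul (qmul (qI R) phi) (qsub (mu_a mu) (qone R))) (qmul phi (mu_b mu)).

(* In the gauge alpha = e^{j beta/2} phi, parallelism reads phi_x = dmu_x phi and
   phi_y = dmu_y phi. *)
Definition dmu_x (b0 : R * R) mu phi : quat R :=
  qsub (qscale (pi / 2) (qmul (qJ R) (qmul (qI R) (qmul (ptC b0) (dmu_coeff mu phi)))))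
       (qscale (pi * b0.1) (qmul (qJ R) phi)).

Definition dmu_y (b0 : R * R) mu phi : quat R :=
  qsub (qmul (qI R) (qscale (pi / 2)
         (qmul (qJ R) (qmul (qI R) (qmul (ptC b0) (dmu_coeff mu phi))))))
       (qscale (pi * b0.2) (qmul (qJ R) phi)).

(** The derivatives [Dx], [Dy] are parameters, so that the equivalence serves both an abstract
    smooth section and an explicit exponential. *)
Lemma dmu_parallel_gauge (w1 w2 b0 : R * R) (f : R * R -> quat R) mu (phi Dx Dy : R * R -> quat R) :
  ham_stationary_torus w1 w2 b0 f ->
  (forall z, qderx phi z (Dx z)) -> (forall z, qdery phi z (Dy z)) ->
  dmu_parallel b0 f mu (fun z => qmul (expj (beta b0 z / 2)) (phi z)) <->
  forall z, Dx z = dmu_x b0 mu (phi z) /\ Dy z = dmu_y b0 mu (phi z).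
Proof.
move=> [_ _ _ _ [g fg]] dx dy.
set al := fun z => qmul (expj (beta b0 z / 2)) (phi z).
set Psi := fun z => qscale (pi / 2)
  (qmul (qJ R) (qmul (qI R) (qmul (ptC b0) (dmu_coeff mu (phi z))))).
have tail z : qmul (qpdx f z) (dmu_tail b0 f mu al z) =
    qopp (qmul (expj (beta b0 z / 2)) (Psi z)).
  have [g0 [fx _]] := fg z.
  have fx0 : qpdx f z <> qzero R by rewrite fx; apply: qmul_neq0 => //; exact: expj_neq0.
  rewrite /dmu_tail /Hmean; set K := qsub (qpdx _ _) _.
  have -> : qadd (qmul (qmul (normalN b0 z) (al z)) (qsub (mu_a mu) (qone R)))
      (qmul (al z) (mu_b mu)) = qmul (expj (beta b0 z / 2)) (dmu_coeff mu (phi z)).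
    rewrite /al qmulA normalN_gauge /dmu_coeff; qring.
  set w := expj _; set Y := dmu_coeff mu (phi z).
  (* Brings f_x next to the inverse of f_x inside [Hmean]. The two factors 1/2 give 1/4, which
     together with 2 pi from the curvature makes pi / 2. *)
  have shuffle s (F V Z : quat R) : qmul F (qscale s (qmul (qopp (qmul V (qscale s K))) Z)) =
      qmul (qmul F V) (qscale (- (s * s)) (qmul K Z)).
    by move: K => K'; qring.
  rewrite shuffle qmulqV // qmul1q curvature_gauge.
  have -> : - (1 / 2 * (1 / 2)) = - (1 / 4) :> R by field.
  rewrite /Psi; move: (qmul (qJ R) _) => X.
  by rewrite -/w; move: w => v; apply: quat_eq => /=; field.
have tail' z : qmul (qpdy f z) (dmu_tail b0 f mu al z) =
    qopp (qmul (expj (beta b0 z / 2)) (qmul (qI R) (Psi z))).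
  have [_ [fx fy]] := fg z.
  (* Conformality f_y = N f_x reduces the y-term to the x-term, with N turned into i by the
     gauge. *)
  have -> : qpdy f z = qmul (normalN b0 z) (qpdx f z).
    by rewrite fy fx !qmulA normalN_gauge.
  rewrite -(qmulA (normalN b0 z)) tail qmulA -normalN_gauge.
  by move: (normalN b0 z) (expj _) (Psi z) => *; qring.
have iffP z (D : quat R) c (P : quat R) :
    qadd (qmul (expj (beta b0 z / 2)) (qadd D (qscale c (qmul (qJ R) (phi z)))))
         (qopp (qmul (expj (beta b0 z / 2)) P)) = qzero R <->
    D = qsub P (qscale c (qmul (qJ R) (phi z))).
  split=> [e|->]; last by qring.
  have : qmul (expj (beta b0 z / 2)) (qadd D (qscale c (qmul (qJ R) (phi z)))) =
      qmul (expj (beta b0 z / 2)) P.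
    by case: e => *; apply: quat_eq => /=; lra.
  by move=> /(qmulI (@expj_neq0 _ _)) <-; qring.
have eqx z := qderx_pdx (gauge_derx b0 (dx z)).
have eqy z := qdery_pdy (gauge_dery b0 (dy z)).
by split=> H z; have := H z; rewrite eqx eqy tail tail' !iffP.
Qed.

End Gauge.

(** * Eigenlines of the constant-coefficient system for mu = lam^-2 *)

Section Spectral.
Variable R : realType.
Implicit Types (z g u A : R * R) (p q c mu lam r phi s : quat R).

Lemma cplxP p : is_cplx p -> exists x y, p = Quat x y 0 0.
Proof. by case: p => x y ? ? [/= -> ->]; exists x, y. Qed.

(** The inverse r of lam is kept as a separate variable, which makes the symmetry (lam, r) to (-
    lam, - r) visible. Here it receives explicit coordinates, for identities settled by [field]. *)
Lemma cplx_invP lam r : is_cplx lam -> is_cplx r -> qmul lam r = qone R ->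
  exists x y, [/\ x ^+ 2 + y ^+ 2 != 0, lam = Quat x y 0 0 &
    r = Quat (x / (x ^+ 2 + y ^+ 2)) (- y / (x ^+ 2 + y ^+ 2)) 0 0].
Proof.
move=> cl cr lr; have [/qnorm2_neq0 l0 _] := qmul_eq1_neq0 lr.
rewrite -(qinv_unique lr); have [x [y e]] := cplxP cl; exists x, y.
move: l0; rewrite e /qnorm2 /= => l0.
have e0 : x ^+ 2 + y ^+ 2 = x ^+ 2 + y ^+ 2 + 0 ^+ 2 + 0 ^+ 2 :> R by ring.
split=> //; first by rewrite e0.
by rewrite e0; apply: quat_eq => //=; rewrite /qnorm2 /= oppr0 mul0r.
Qed.

Definition spinor lam : quat R := qsub (qone R) (qmul (qK R) lam).

(* For r = lam^-1 the exponent is E = 2 pi (<growth, z> + i <freq, z>), with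
   E_x = (i pi / 2) (b0 lam + conj(b0) r) and E_y = (pi / 2) (b0 lam - conj(b0) r). *)
Definition freq (b0 : R * R) lam r : R * R :=
  ((b0.1 * (q0 lam + q0 r) + b0.2 * (q1 r - q1 lam)) / 4,
   (b0.1 * (q1 lam - q1 r) + b0.2 * (q0 lam + q0 r)) / 4).

Definition growth (b0 : R * R) lam r : R * R :=
  (- (b0.1 * (q1 lam + q1 r) + b0.2 * (q0 lam - q0 r)) / 4,
   (b0.1 * (q0 lam - q0 r) - b0.2 * (q1 lam + q1 r)) / 4).

Definition eigen_x (b0 : R * R) lam r : quat R :=
  Quat (2 * pi * (growth b0 lam r).1) (2 * pi * (freq b0 lam r).1) 0 0.

Definition eigen_y (b0 : R * R) lam r : quat R :=
  Quat (2 * pi * (growth b0 lam r).2) (2 * pi * (freq b0 lam r).2) 0 0.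

(* For r = lam^-1: the coordinate of phi along spinor lam in the right complex
   basis (spinor lam, spinor (- lam)) of H. *)
Definition spinor_coord r phi : quat R :=
  Quat ((q0 phi + q1 r * q2 phi - q0 r * q3 phi) / 2)
       ((q1 phi - q0 r * q2 phi - q1 r * q3 phi) / 2) 0 0.

(** The coordinate as a sum of left and right multiplications by constants, a form to which [qderMl]
    and [qderMr] apply. *)
Lemma spinor_coordE r phi : is_cplx r ->
  let e := qmul (qmul (qI R) r) (qJ R) in
  spinor_coord r phi =
  qadd (qmul (qscale (1 / 4) (qadd (qone R) e)) phi)
       (qmul (qmul (qscale (1 / 4) (qmul (qsub e (qone R)) (qI R))) phi) (qI R)).
Proof. by move=> /cplxP [x [y ->]]; apply: quat_eq => /=; field. Qed.

Lemma spinor_coordD r phi psi :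
  spinor_coord r (qadd phi psi) = qadd (spinor_coord r phi) (spinor_coord r psi).
Proof. by apply: quat_eq => /=; field. Qed.

Lemma spinor_decomposition lam r phi :
  is_cplx lam -> is_cplx r -> qmul lam r = qone R ->
  phi = qadd (qmul (spinor lam) (spinor_coord r phi))
             (qmul (spinor (qopp lam)) (spinor_coord (qopp r) phi)).
Proof.
move=> cl cr /(cplx_invP cl cr) [x [y [n0 -> ->]]].
by apply: quat_eq => /=; field.
Qed.

Lemma spinor_coordK lam r s :
  is_cplx lam -> is_cplx r -> qmul lam r = qone R -> is_cplx s ->
  spinor_coord r (qmul (spinor lam) s) = s.
Proof.
move=> cl cr /(cplx_invP cl cr) [x [y [n0 -> ->]]] /cplxP [a [b ->]].
by apply: quat_eq => /=; field.
Qed.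

Lemma spinor_coord_opp lam r s :
  is_cplx lam -> is_cplx r -> qmul lam r = qone R -> is_cplx s ->
  spinor_coord r (qmul (spinor (qopp lam)) s) = qzero R.
Proof.
move=> cl cr /(cplx_invP cl cr) [x [y [n0 -> ->]]] /cplxP [a [b ->]].
by apply: quat_eq => /=; field.
Qed.

Lemma spinor_coord_cplx r phi : is_cplx (spinor_coord r phi).
Proof. by []. Qed.

Lemma spinor_coordMr r phi c : is_cplx c ->
  spinor_coord r (qmul phi c) = qmul (spinor_coord r phi) c.
Proof. by move=> /cplxP [x [y ->]]; apply: quat_eq => /=; field. Qed.

Lemma mu_E lam r : is_cplx lam -> is_cplx r -> qmul lam r = qone R ->
  mu_a (qmul r r) = qscale (1 / 2) (qadd (qmul r r) (qmul lam lam)) /\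
  mu_b (qmul r r) = qmul (qscale (1 / 2) (qsub (qmul lam lam) (qmul r r))) (qI R).
Proof.
move=> cl cr lr; rewrite /mu_a /mu_b (@qinv_unique _ _ (qmul lam lam)) //.
rewrite qmulA -(qmulA r) (qmul_cplxC cr cl) lr qmulq1.
by rewrite (qmul_cplxC cr cl).
Qed.

(** Here the choice mu = lam^-2 pays off: with b = b' i, the complex part contains only a + b' =
    lam^2 and the j-part only a - b' = r^2. *)
Lemma dmu_coeff_spinor lam r s :
  is_cplx lam -> is_cplx r -> qmul lam r = qone R -> is_cplx s ->
  dmu_coeff (qmul r r) (qmul (spinor lam) s) =
  qmul (qadd (qmul (qI R) (qsub (qmul lam lam) (qone R))) (qmul (qJ R) (qsub r lam))) s.
Proof.
move=> cl cr lr /cplxP [a [b ->]]; have [ma mb] := mu_E cl cr lr.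
(* With r written as lam r r, both sides agree as polynomials, without any further use of lam r =
   1. *)
have -> : qsub r lam = qsub (qmul (qmul lam r) r) lam by rewrite lr qmul1q.
rewrite /dmu_coeff ma mb.
have [x [y ->]] := cplxP cl; have [x' [y' ->]] := cplxP cr.
by apply: quat_eq => /=; field.
Qed.

Lemma dmu_spinor (b0 : R * R) lam r s :
  is_cplx lam -> is_cplx r -> qmul lam r = qone R -> is_cplx s ->
  dmu_x b0 (qmul r r) (qmul (spinor lam) s) =
    qmul (spinor lam) (qmul (eigen_x b0 lam r) s) /\
  dmu_y b0 (qmul r r) (qmul (spinor lam) s) =
    qmul (spinor lam) (qmul (eigen_y b0 lam r) s).
Proof.
move=> cl cr lr cs; rewrite /dmu_x /dmu_y dmu_coeff_spinor //.
(* The operators are right linear, so s factors out and the case s = 1 remains. *)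
have lin (c d : R) p q v : qsub (qscale c (qmul (qJ R) (qmul (qI R) (qmul p (qmul q s)))))
    (qscale d (qmul (qJ R) (qmul v s))) =
    qmul (qsub (qscale c (qmul (qJ R) (qmul (qI R) (qmul p q))))
               (qscale d (qmul (qJ R) v))) s by qring.
have lin' (c d : R) p q v :
    qsub (qmul (qI R) (qscale c (qmul (qJ R) (qmul (qI R) (qmul p (qmul q s))))))
         (qscale d (qmul (qJ R) (qmul v s))) =
    qmul (qsub (qmul (qI R) (qscale c (qmul (qJ R) (qmul (qI R) (qmul p q)))))
               (qscale d (qmul (qJ R) v))) s by qring.
rewrite lin lin' (qmulA (spinor lam) (eigen_x b0 lam r)).
rewrite (qmulA (spinor lam) (eigen_y b0 lam r)).
move: lr; have [x [y ->]] := cplxP cl; have [x' [y' ->]] := cplxP cr => lr.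
have e0 : x * x' = 1 + y * y' by case: lr => e _ _ _; lra.
have e1 : x * y' = - (y * x') by case: lr => _ e _ _; lra.
(* [e0] and [e1] are the real and imaginary parts of lam r = 1. *)
by split; congr (qmul _ s); apply: quat_eq => /=; field: e0 e1.
Qed.

Lemma dmuD (b0 : R * R) mu phi psi :
  dmu_x b0 mu (qadd phi psi) = qadd (dmu_x b0 mu phi) (dmu_x b0 mu psi) /\
  dmu_y b0 mu (qadd phi psi) = qadd (dmu_y b0 mu phi) (dmu_y b0 mu psi).
Proof.
rewrite /dmu_x /dmu_y.
have -> : dmu_coeff mu (qadd phi psi) = qadd (dmu_coeff mu phi) (dmu_coeff mu psi).
  by rewrite /dmu_coeff; move: (qsub _ _) (mu_b _) => *; qring.
by move: (dmu_coeff _ _) (dmu_coeff _ _) => *; split; qring.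
Qed.

(** This decouples the system: each coordinate of phi obeys a scalar equation with a constant
    complex coefficient. *)
Lemma dmu_spinor_coord (b0 : R * R) lam r phi :
  is_cplx lam -> is_cplx r -> qmul lam r = qone R ->
  spinor_coord r (dmu_x b0 (qmul r r) phi) =
    qmul (eigen_x b0 lam r) (spinor_coord r phi) /\
  spinor_coord r (dmu_y b0 (qmul r r) phi) =
    qmul (eigen_y b0 lam r) (spinor_coord r phi).
Proof.
move=> cl cr lr; rewrite {1 3}(spinor_decomposition phi cl cr lr).
have lr' : qmul (qopp lam) (qopp r) = qone R by rewrite qmulNN.
have cs q := spinor_coord_cplx q phi.
have [-> ->] := dmuD b0 (qmul r r) (qmul (spinor lam) (spinor_coord r phi))
  (qmul (spinor (qopp lam)) (spinor_coord (qopp r) phi)).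
have [-> ->] := dmu_spinor b0 cl cr lr (cs r).
(* The second eigenline belongs to the same mu, because (- r)(- r) = r r. *)
rewrite -(qmulNN r r).
have [-> ->] := dmu_spinor b0 (is_cplx_opp cl) (is_cplx_opp cr) lr' (cs (qopp r)).
have q0r p : qadd p (qzero R) = p by qring.
by split; rewrite spinor_coordD (spinor_coordK cl cr) ?(spinor_coord_opp cl cr) ?q0r //;
  apply: is_cplx_mul.
Qed.

End Spectral.

(** * Exponential solutions and their match with monochromatic sections *)

Section Modes.
Variable R : realType.
Implicit Types (z g u A : R * R) (p q c mu lam r s : quat R).

Definition popp u : R * R := (- u.1, - u.2).

Definition cexp u A z : quat R :=
  qmul (expi (2 * pi * dot u z)) (qreal (expR (2 * pi * dot A z))).

Lemma cexp_cplx u A z : is_cplx (cexp u A z).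
Proof. by apply: is_cplx_mul. Qed.

Lemma qnorm2_cexp u A z : qnorm2 (cexp u A z) = expR (2 * pi * dot A z) ^+ 2.
Proof. by rewrite qnorm2M qnorm2_expi mul1r /qnorm2 /=; ring. Qed.

Lemma cexp_neq0 u A z : cexp u A z <> qzero R.
Proof.
by apply: qnorm2_neq0P; rewrite qnorm2_cexp expf_neq0 // gt_eqF // expR_gt0.
Qed.

Lemma cexpD u A z g : cexp u A (padd z g) = qmul (cexp u A z) (cexp u A g).
Proof.
have dotD v : 2 * pi * dot v (padd z g) = 2 * pi * dot v z + 2 * pi * dot v g.
  by rewrite /dot /=; ring.
by rewrite /cexp !dotD expiD expRD; move: (expi _) (expi _) => *; qring.
Qed.

Lemma cexp0 u A : cexp u A (0, 0) = qone R.
Proof.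
rewrite /cexp /dot /= !mulr0 !addr0 !mulr0 expR0 /expi cos0 sin0; qring.
Qed.

Lemma cexpNK u A z : qmul (cexp u A z) (cexp (popp u) (popp A) z) = qone R.
Proof.
have dotN v : 2 * pi * dot (popp v) z = - (2 * pi * dot v z) by rewrite /dot /=; ring.
have := expRxMexpNx_1 (2 * pi * dot A z); have := sin2cos2 (2 * pi * dot u z).
rewrite /cexp /expi !dotN cosN sinN.
move: (expR _) (expR _) (cos _) (sin _) => e e' x y y2 ee'.
by apply: quat_eq => /=; ring: y2 ee'.
Qed.

Lemma cexp_derx u A z :
  qderx (cexp u A) z (qmul (Quat (2 * pi * A.1) (2 * pi * u.1) 0 0) (cexp u A z)).
Proof.
have E v t : 2 * pi * dot v (t, z.2) = 2 * pi * v.1 * t + 2 * pi * v.2 * z.2.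
  by rewrite /dot /=; ring.
have Ez v : 2 * pi * dot v z = 2 * pi * v.1 * z.1 + 2 * pi * v.2 * z.2
  by rewrite -E -surjective_pairing.
rewrite /qderx /cexp; under eq_fun do rewrite !E.
by apply: qder_eq (qderM (qder_expi _ _ _) (qder_expR _ _ _)) _; rewrite !Ez; qring.
Qed.

Lemma cexp_dery u A z :
  qdery (cexp u A) z (qmul (Quat (2 * pi * A.2) (2 * pi * u.2) 0 0) (cexp u A z)).
Proof.
have E v t : 2 * pi * dot v (z.1, t) = 2 * pi * v.2 * t + 2 * pi * v.1 * z.1.
  by rewrite /dot /=; ring.
have Ez v : 2 * pi * dot v z = 2 * pi * v.2 * z.2 + 2 * pi * v.1 * z.1
  by rewrite -E -surjective_pairing.
rewrite /qdery /cexp; under eq_fun do rewrite !E.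
by apply: qder_eq (qderM (qder_expi _ _ _) (qder_expR _ _ _)) _; rewrite !Ez; qring.
Qed.

Definition wave (b0 : R * R) lam r z := cexp (freq b0 lam r) (growth b0 lam r) z.

Definition mode (b0 : R * R) lam r z := qmul (spinor lam) (wave b0 lam r z).

Lemma qder_spinor_coord r (F : R -> quat R) t D : is_cplx r ->
  qder F t D -> qder (fun x => spinor_coord r (F x)) t (spinor_coord r D).
Proof.
move=> cr dF; under eq_fun do rewrite (spinor_coordE _ cr).
by rewrite (spinor_coordE _ cr); apply: qderD (qderMl _ dF) (qderMr _ (qderMl _ dF)).
Qed.

(** The coordinate times e^{-E} has vanishing partial derivatives, hence equals its value at the
    origin. *)
Lemma spinor_coord_wave (b0 : R * R) lam r (phi : R * R -> quat R) :
  is_cplx lam -> is_cplx r -> qmul lam r = qone R ->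
  (forall z, qderx phi z (dmu_x b0 (qmul r r) (phi z))) ->
  (forall z, qdery phi z (dmu_y b0 (qmul r r) (phi z))) ->
  forall z, spinor_coord r (phi z) =
    qmul (wave b0 lam r z) (spinor_coord r (phi (0, 0))).
Proof.
move=> cl cr lr dx dy.
set u := freq b0 lam r; set A := growth b0 lam r.
have F z : qmul (spinor_coord r (phi z)) (cexp (popp u) (popp A) z) =
    qmul (spinor_coord r (phi (0, 0))) (cexp (popp u) (popp A) (0, 0)).
  have cancel (P s E : R * R -> quat R) z0 : is_cplx (s z0) -> is_cplx (P z0) ->
     qadd (qmul (qmul (P z0) (s z0)) (E z0))
          (qmul (s z0) (qmul (qopp (P z0)) (E z0))) = qzero R.
    by move=> cs cP; rewrite (qmul_cplxC cP cs); move: (s z0) (P z0) (E z0) => *; qring.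
  apply: (@qder0_cst2 _
    (fun z => qmul (spinor_coord r (phi z)) (cexp (popp u) (popp A) z))) => {}z.
  - have [ex _] := dmu_spinor_coord b0 (phi z) cl cr lr.
    apply: qder_eq (qderM (qder_spinor_coord cr (dx z)) (cexp_derx (popp u) (popp A) z)) _.
    rewrite ex -surjective_pairing.
    have -> : Quat (2 * pi * (popp A).1) (2 * pi * (popp u).1) 0 0 =
        qopp (eigen_x b0 lam r).
      by qring.
    exact: (cancel (fun=> eigen_x b0 lam r) (fun z => spinor_coord r (phi z))
                   (cexp (popp u) (popp A))).
  - have [_ ey] := dmu_spinor_coord b0 (phi z) cl cr lr.
    apply: qder_eq (qderM (qder_spinor_coord cr (dy z)) (cexp_dery (popp u) (popp A) z)) _.
    rewrite ey -surjective_pairing.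
    have -> : Quat (2 * pi * (popp A).2) (2 * pi * (popp u).2) 0 0 =
        qopp (eigen_y b0 lam r).
      by qring.
    exact: (cancel (fun=> eigen_y b0 lam r) (fun z => spinor_coord r (phi z))
                   (cexp (popp u) (popp A))).
move=> z; have := F z; rewrite cexp0 qmulq1 => <-.
rewrite (qmul_cplxC (spinor_coord_cplx _ _) (cexp_cplx _ _ _)) qmulA /wave -/u -/A.
by rewrite cexpNK qmul1q.
Qed.

Lemma dmu_solution (b0 : R * R) lam r (phi : R * R -> quat R) :
  is_cplx lam -> is_cplx r -> qmul lam r = qone R ->
  (forall z, qderx phi z (dmu_x b0 (qmul r r) (phi z))) ->
  (forall z, qdery phi z (dmu_y b0 (qmul r r) (phi z))) ->
  exists c1 c2, [/\ is_cplx c1, is_cplx c2 & forall z, phi z =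
    qadd (qmul (mode b0 lam r z) c1) (qmul (mode b0 (qopp lam) (qopp r) z) c2)].
Proof.
move=> cl cr lr dx dy.
exists (spinor_coord r (phi (0, 0))), (spinor_coord (qopp r) (phi (0, 0))).
split=> // z; rewrite {1}(spinor_decomposition (phi z) cl cr lr).
have lr' : qmul (qopp lam) (qopp r) = qone R by rewrite qmulNN.
rewrite (spinor_coord_wave cl cr lr dx dy) /mode -(qmulA (spinor lam)).
congr qadd; rewrite -(qmulA (spinor (qopp lam))); congr qmul.
by apply: (@spinor_coord_wave b0 (qopp lam) (qopp r)); rewrite ?qmulNN //;
  apply: is_cplx_opp.
Qed.

Lemma mode_parallel (w1 w2 b0 : R * R) (f : R * R -> quat R) lam r c :
  ham_stationary_torus w1 w2 b0 f ->
  is_cplx lam -> is_cplx r -> qmul lam r = qone R -> is_cplx c ->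
  dmu_parallel b0 f (qmul r r)
    (fun z => qmul (expj (beta b0 z / 2)) (qmul (mode b0 lam r z) c)).
Proof.
move=> hf cl cr lr cc.
apply/(@dmu_parallel_gauge _ _ _ _ _ _ (fun z => qmul (mode b0 lam r z) c)
  (fun z => qmul (qmul (spinor lam) (qmul (eigen_x b0 lam r) (wave b0 lam r z))) c)
  (fun z => qmul (qmul (spinor lam) (qmul (eigen_y b0 lam r) (wave b0 lam r z))) c) hf) => z.
- by apply: qderMr; apply: qderMl; exact: cexp_derx.
- by apply: qderMr; apply: qderMl; exact: cexp_dery.
- have cs : is_cplx (qmul (wave b0 lam r z) c).
    by apply: is_cplx_mul => //; exact: cexp_cplx.
  have [] := dmu_spinor b0 cl cr lr cs; rewrite /mode -!qmulA => -> ->.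
  by split.
Qed.

(** These are the equations of Gamma*_{A,B} for delta - B = [freq] and A = [growth]. Their left
    sides are |b0|^2/4 times Re(lam r) and - |b0|^2/8 times Im(lam r). *)
Lemma growth_quadric (b0 : R * R) lam r : qmul lam r = qone R ->
  is_cplx lam -> is_cplx r ->
  dot (freq b0 lam r) (freq b0 lam r) - dot (growth b0 lam r) (growth b0 lam r) =
    dot b0 b0 / 4 /\ dot (freq b0 lam r) (growth b0 lam r) = 0.
Proof.
move=> lr /cplxP [x [y el]] /cplxP [x' [y' er]]; move: lr; rewrite el er => lr.
have e0 : x * x' - y * y' = 1 by case: lr => e _ _ _; lra.
have e1 : x * y' + y * x' = 0 by case: lr => _ e _ _; lra.
split; last transitivity (- dot b0 b0 / 8 * (x * y' + y * x')).
- transitivity (dot b0 b0 / 4 * (x * x' - y * y')); last by rewrite e0 mulr1.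
  by rewrite /dot /freq /growth /=; field.
- by rewrite /dot /freq /growth /=; field.
- by rewrite e1 mulr0.
Qed.

Lemma ptC_neq0 (b0 : R * R) : b0 != (0, 0) -> ptC b0 <> qzero R.
Proof. by case: b0 => x y /eqP b00 [x0 y0]; apply: b00; rewrite x0 y0. Qed.

(** B may be any vector, so delta = b0/2 can always be taken: delta - b0/2 = 0 is in the dual
    lattice, and B = b0/2 - [freq] gives the required frequency. *)
Lemma mode_monochromatic (w1 w2 b0 : R * R) lam r : b0 != (0, 0) ->
  is_cplx lam -> is_cplx r -> qmul lam r = qone R ->
  monochromatic w1 w2 b0 (fun z => qmul (expj (beta b0 z / 2)) (mode b0 lam r z)).
Proof.
move=> b00 cl cr lr; have [quad orth] := growth_quadric b0 lr cl cr.
set u := freq b0 lam r in quad orth; set A := growth b0 lam r in quad orth.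
have uE : psub (pscale (1 / 2) b0) (psub (pscale (1 / 2) b0) u) = u.
  by rewrite [RHS]surjective_pairing; congr pair => /=; ring.
have lamE : lambda_d b0 A (psub (pscale (1 / 2) b0) u) (pscale (1 / 2) b0) = lam.
  rewrite /lambda_d.
  (* In [freq] - i [growth] the terms with r cancel, leaving b0 lam / 2. *)
  have -> : qsub (qsub (ptC (pscale (1 / 2) b0)) (qmul (qI R) (ptC A)))
      (ptC (psub (pscale (1 / 2) b0) u)) = qscale (1 / 2) (qmul (ptC b0) lam).
    rewrite /u /A; move: cl cr => /cplxP [x [y ->]] /cplxP [x' [y' ->]].
    by apply: quat_eq => /=; field.
  have -> : qmul (qscale 2 (qinv (ptC b0))) (qscale (1 / 2) (qmul (ptC b0) lam)) =
      qmul (qmul (qinv (ptC b0)) (ptC b0)) lam.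
    by move: (ptC b0) => v; move: (qinv v) => v'; apply: quat_eq => /=; field.
  by rewrite qmulVq ?qmul1q //; exact: ptC_neq0.
exists A, (psub (pscale (1 / 2) b0) u), (pscale (1 / 2) b0), (qone R).
rewrite lamE uE; split=> //.
- split; rewrite ?uE // => g _; exists 0; rewrite /dot /= subrr subrr; ring.
- by case=> /eqP; rewrite oner_eq0.
- by move=> z; rewrite qmulq1 -!qmulA.
Qed.

Lemma monochromatic_mode (w1 w2 b0 : R * R) (alpha : R * R -> quat R) : b0 != (0, 0) ->
  monochromatic w1 w2 b0 alpha -> exists lam r c,
    [/\ is_cplx lam, is_cplx r, qmul lam r = qone R, is_cplx c /\ c <> qzero R &
     alpha = fun z => qmul (expj (beta b0 z / 2)) (qmul (mode b0 lam r z) c)].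
Proof.
move=> b00 [A [B [d [c [[_ quad orth] cc c0 alphaE]]]]].
set u := psub d B in quad orth alphaE.
have n0 : b0.1 ^+ 2 + b0.2 ^+ 2 != 0.
  apply: contra_neq b00 => e; rewrite [b0]surjective_pairing.
  have : b0.1 ^+ 2 = 0 /\ b0.2 ^+ 2 = 0 by have := (sqr_ge0 b0.1, sqr_ge0 b0.2) => -[]; lra.
  by case=> /eqP + /eqP; rewrite !sqrf_eq0 => /eqP -> /eqP ->.
set n := b0.1 ^+ 2 + b0.2 ^+ 2 in n0.
have lamE : lambda_d b0 A B d =
    Quat (2 / n * (b0.1 * (u.1 + A.2) + b0.2 * (u.2 - A.1)))
         (2 / n * (b0.1 * (u.2 - A.1) - b0.2 * (u.1 + A.2))) 0 0.
  have -> : n = qnorm2 (ptC b0) by rewrite /n /qnorm2 /=; ring.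
  have : qnorm2 (ptC b0) != 0 by rewrite /qnorm2 /= expr0n /= !addr0.
  rewrite /lambda_d /qinv; move: (qnorm2 _) => m m0.
  by apply: quat_eq => /=; field.
set lam := lambda_d b0 A B d in lamE alphaE.
(* r is the complex conjugate of (2/b0)(u + iA), while lam = (2/b0)(u - iA). Hence lam r =
   (4/|b0|^2)(|u|^2 - |A|^2 - 2i <u,A>), and the two equations of Gamma*_{A,B} say that this is
   1. *)
pose r : quat R := Quat (2 / n * (b0.1 * (u.1 - A.2) + b0.2 * (u.2 + A.1)))
  (2 / n * (b0.2 * (u.1 - A.2) - b0.1 * (u.2 + A.1))) 0 0.
have lr : qmul lam r = qone R.
  have -> : qmul lam r =
      Quat (4 / n * (dot u u - dot A A)) (- 8 / n * dot u A) 0 0.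
    by rewrite lamE /r /dot /n; apply: quat_eq => /=; field.
  rewrite quad orth /dot -!expr2 -/n; apply: quat_eq => /=; by field.
have uE : freq b0 lam r = u.
  rewrite lamE /r [RHS]surjective_pairing /freq /n; congr pair => /=; by field.
have AE : growth b0 lam r = A.
  rewrite lamE /r [RHS]surjective_pairing /growth /n; congr pair => /=; by field.
exists lam, r, c; split=> //; first by rewrite lamE.
by apply/funext => z; rewrite alphaE /mode /wave uE AE /cexp -!qmulA.
Qed.

End Modes.

(** * Multipliers, and right multiples of a section with the same transform *)

Section Darboux.
Variable R : realType.
Implicit Types (z g u A : R * R) (p q c mu lam r s : quat R).

(** T stands to the left of alpha in d alpha = - df T alpha, so the same T serves alpha q. The
    homogeneous coordinates only gain a right factor q, which the quaternionic line absorbs. *)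
Lemma darboux_transform_mulr (b0 : R * R) (f alpha : R * R -> quat R) q
    (fhat : R * R -> quat R * quat R) : q <> qzero R ->
  darboux_transform b0 f alpha fhat ->
  darboux_transform b0 f (fun z => qmul (alpha z) q) fhat.
Proof.
move=> q0 [sa a0 ha [T [Tx [Ty Tf]]]].
have ax z : qpdx (fun z => qmul (alpha z) q) z = qmul (qpdx alpha z) q.
  by apply: qderx_pdx; apply: qderMr; exact: smooth_qderx.
have ay z : qpdy (fun z => qmul (alpha z) q) z = qmul (qpdy alpha z) q.
  by apply: qdery_pdy; apply: qderMr; exact: smooth_qdery.
have oppMl p p' : qmul (qopp p) p' = qopp (qmul p p') by qring.
split; first exact: smoothQ_mulr.
- by move=> z; apply: qmul_neq0.
- by move=> z; have [e1 e2] := ha z; rewrite ax ay qmulA -e1 qmulA -e2 oppMl.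
exists T; split=> [z|]; first by rewrite ax Tx oppMl -qmulA.
split=> [z|z nu]; first by rewrite ay Ty oppMl -qmulA.
have [p [p0 [e1 e2]]] := Tf z.
exists (qmul (qinv q) p); split; first by apply: qmul_neq0 => //; exact: qinv_neq0.
have cancel x : qmul (qmul x q) (qmul (qinv q) p) = qmul x p.
  by rewrite -qmulA (qmulA q) qmulqV // qmul1q.
rewrite /nu /= !qmulA -qmulDl -!(qmulA _ (qinv q)) !cancel; split; last exact: e2.
by rewrite e1 /= qmulA.
Qed.

Lemma cplx_sqrt mu : is_cplx mu -> exists r, is_cplx r /\ mu = qmul r r.
Proof.
move=> /cplxP [x [y ->]].
have := complex.sqr_sqrtc (complex.Complex x y).
case: (complex.sqrtc _) => a b; rewrite expr2 => -[<- <-].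
by exists (Quat a b 0 0); split=> //; qring.
Qed.

(** <b0, g> is an integer k, so beta/2 shifts by pi k and the gauge is periodic up to the real sign
    cos(pi k), which commutes with everything. *)
Lemma gauge_translate (w1 w2 b0 : R * R) g :
  in_dual w1 w2 b0 -> in_lattice w1 w2 g ->
  cos (pi * dot b0 g) != 0 /\ forall z,
  expj (beta b0 (padd z g) / 2) = qscale (cos (pi * dot b0 g)) (expj (beta b0 z / 2)).
Proof.
move=> db lg; have [k e] := db g lg; rewrite e; split=> [|z].
  exact: cos_intpi_neq0.
have -> : beta b0 (padd z g) / 2 = beta b0 z / 2 + pi * k%:~R.
  by rewrite -e /beta /dot /=; field.
by rewrite expjD /(expj (pi * _)) sin_intpi; qring.
Qed.

(** The multiplier is the gauge sign times e^E at g; it passes to the right of c because both are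
    complex. *)
Lemma mode_multiplier (w1 w2 b0 : R * R) lam r c :
  in_dual w1 w2 b0 -> is_cplx c ->
  has_multiplier w1 w2
    (fun z => qmul (expj (beta b0 z / 2)) (qmul (mode b0 lam r z) c)).
Proof.
move=> db cc.
exists (fun g => qscale (cos (pi * dot b0 g)) (wave b0 lam r g)) => g lg.
have [n0 tr] := gauge_translate db lg.
have cw : is_cplx (wave b0 lam r g) by exact: cexp_cplx.
split.
- have cscale x p : is_cplx p -> is_cplx (qscale x p).
    by move=> [p2 p3]; split; rewrite /= ?p2 ?p3 mulr0.
  exact: cscale.
- move=> /(congr1 (@qnorm2 R)) /eqP.
  have -> : qnorm2 (qscale (cos (pi * dot b0 g)) (wave b0 lam r g)) =
    cos (pi * dot b0 g) ^+ 2 * qnorm2 (wave b0 lam r g) by rewrite /qnorm2 /=; ring.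
  have -> : qnorm2 (qzero R) = 0 by rewrite /qnorm2 /=; ring.
  by rewrite mulf_eq0 sqrf_eq0 (negbTE n0) /= => /eqP /qnorm2_eq0 /cexp_neq0.
- move=> z; have -> : mode b0 lam r (padd z g) = qmul (mode b0 lam r z) (wave b0 lam r g).
    by rewrite /mode {1}/wave cexpD qmulA.
  rewrite tr -(qmulA (mode b0 lam r z)) (qmul_cplxC cw cc).
  by move: (expj _) (mode b0 lam r z) (wave b0 lam r g) => *; qring.
Qed.

(** Cramer's rule for the two equations in A. *)
Lemma lattice_dot_eq0 (w1 w2 : R * R) A : lattice_basis w1 w2 ->
  dot A w1 = 0 -> dot A w2 = 0 -> A = (0, 0).
Proof.
rewrite /lattice_basis /dot => D e1 e2; rewrite [A]surjective_pairing.
have a1 : A.1 * (w1.1 * w2.2 - w1.2 * w2.1) = 0.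
  transitivity (w2.2 * (A.1 * w1.1 + A.2 * w1.2) - w1.2 * (A.1 * w2.1 + A.2 * w2.2)).
    by ring.
  by rewrite e1 e2; ring.
have a2 : A.2 * (w1.1 * w2.2 - w1.2 * w2.1) = 0.
  transitivity (w1.1 * (A.1 * w2.1 + A.2 * w2.2) - w2.1 * (A.1 * w1.1 + A.2 * w1.2)).
    by ring.
  by rewrite e1 e2; ring.
move/eqP: a1; rewrite mulf_eq0 (negbTE D) orbF => /eqP ->.
by move/eqP: a2; rewrite mulf_eq0 (negbTE D) orbF => /eqP ->.
Qed.

Lemma wave_opp (b0 : R * R) lam r z :
  wave b0 (qopp lam) (qopp r) z = cexp (popp (freq b0 lam r)) (popp (growth b0 lam r)) z.
Proof.
rewrite /wave; congr cexp; rewrite /freq /growth /popp; congr pair => /=; ring.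
Qed.

Lemma multiplier_growth0 (w1 w2 b0 : R * R) lam r c1 c2 (alpha : R * R -> quat R) :
  lattice_basis w1 w2 -> in_dual w1 w2 b0 ->
  is_cplx lam -> is_cplx r -> qmul lam r = qone R -> is_cplx c1 -> is_cplx c2 ->
  c1 <> qzero R -> c2 <> qzero R ->
  (forall z, alpha z = qmul (expj (beta b0 z / 2))
     (qadd (qmul (mode b0 lam r z) c1) (qmul (mode b0 (qopp lam) (qopp r) z) c2))) ->
  has_multiplier w1 w2 alpha -> growth b0 lam r = (0, 0).
Proof.
move=> lb db cl cr lr cc1 cc2 n1 n2 alphaE [h hE].
set A := growth b0 lam r.
have lr' : qmul (qopp lam) (qopp r) = qone R by rewrite qmulNN.
have cw lam' r' z : is_cplx (wave b0 lam' r' z) by exact: cexp_cplx.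
(* The multiplier relation is used at z = 0 only, where both waves are 1. *)
have dotA0 g : in_lattice w1 w2 g -> dot A g = 0.
  move=> lg; have [chg _ /(_ (0, 0))] := hE g lg.
  have [s0 tr] := gauge_translate db lg; rewrite !alphaE tr -qmulA.
  move: (cos _) s0 => s s0.
  have padd0 : padd (0, 0) g = g by rewrite /padd /= !add0r -surjective_pairing.
  rewrite padd0; set w := expj _.
  have pull p q : qmul (qscale s p) q = qmul p (qscale s q) by qring.
  rewrite pull => /(qmulI (@expj_neq0 _ _)).
  have wave0 lam' r' : wave b0 lam' r' (0, 0) = qone R by exact: cexp0.
  have oppK p : qopp (qopp p) = p by qring.
  have scaleP (p : quat R) : qscale s p = qmul p (qreal s) by qring.
  have crs : is_cplx (qreal s) by [].
  rewrite scaleP /mode !wave0 !qmulq1 -!(qmulA (spinor _)) => e.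
  have ce1 : is_cplx (qmul (wave b0 lam r g) c1) by exact: is_cplx_mul.
  have ce2 : is_cplx (qmul (wave b0 (qopp lam) (qopp r) g) c2) by exact: is_cplx_mul.
  have add0q p : qadd (qzero R) p = p by qring.
  have addq0 p : qadd p (qzero R) = p by qring.
  (* Projection to the two eigenlines separates the waves; as c1 and c2 are nonzero, each wave at g,
     scaled by s, must equal h g. *)
  have /(congr1 (spinor_coord r)) := e; have /(congr1 (spinor_coord (qopp r))) := e.
  have K1 c : is_cplx c -> spinor_coord (qopp r) (qmul (spinor lam) c) = qzero R.
    move=> cc; rewrite -{1}(oppK lam); apply: (@spinor_coord_opp _ (qopp lam)) => //;
    exact: is_cplx_opp.
  have K2 c : is_cplx c -> spinor_coord (qopp r) (qmul (spinor (qopp lam)) c) = c.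
    by move=> cc; apply: (@spinor_coordK _ (qopp lam)) => //; exact: is_cplx_opp.
  rewrite !spinor_coordMr // !spinor_coordD !K1 // !K2 // !(spinor_coordK cl cr lr) //.
  rewrite !(spinor_coord_opp cl cr lr) // !add0q !addq0.
  move=> e2 e1.
  have swap (p q q' : quat R) : is_cplx q -> q <> qzero R -> is_cplx q' ->
      qmul (qmul p q) (qreal s) = qmul q q' -> qscale s p = q'.
    move=> cq nq cq' epq; apply: (qmulIr nq); rewrite (qmul_cplxC cq' cq) -epq; qring.
  have {}e1 := swap _ _ _ cc1 n1 chg e1; have {}e2 := swap _ _ _ cc2 n2 chg e2.
  have : qscale s (wave b0 lam r g) = qscale s (wave b0 (qopp lam) (qopp r) g).
    by rewrite e1 e2.
  (* Norms forget the phases and leave an equality of e^{2 pi <A,g>} with its inverse. *)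
  move=> /(congr1 (@qnorm2 R)).
  have nscale (p : quat R) : qnorm2 (qscale s p) = s ^+ 2 * qnorm2 p.
    by rewrite /qnorm2 /=; ring.
  rewrite !nscale => /(mulfI (expf_neq0 2 s0)); rewrite wave_opp !qnorm2_cexp => /eqP.
  rewrite eqrXn2 ?expR_ge0 // => /eqP/expR_inj; rewrite -/A.
  have -> : 2 * pi * dot (popp A) g = - (2 * pi * dot A g) by rewrite /dot /=; ring.
  move=> e0; have /eqP : (4 * pi) * dot A g = 0 by lra.
  by rewrite mulf_eq0 mulf_eq0 pnatr_eq0 /= (gt_eqF (pi_gt0 R)) => /eqP.
apply: (lattice_dot_eq0 lb); apply: dotA0.
- by exists 1, 0; rewrite [w1]surjective_pairing /padd /pscale /=; congr pair; ring.
- by exists 0, 1; rewrite [w2]surjective_pairing /padd /pscale /=; congr pair; ring.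
Qed.

(** Zero growth makes r the conjugate of lam, so |lam| = 1. Moving j leftwards past e^E turns it
    into e^{-E}, and the factor - i lam is chosen so that (1 - k lam) j (- i lam) = |lam|^2 + k lam
    = 1 + k lam. *)
Lemma mode_opp_growth0 (b0 : R * R) lam r z : b0 != (0, 0) ->
  is_cplx lam -> is_cplx r -> qmul lam r = qone R -> growth b0 lam r = (0, 0) ->
  mode b0 (qopp lam) (qopp r) z =
  qmul (mode b0 lam r z) (qmul (qJ R) (qopp (qmul (qI R) lam))).
Proof.
move=> b00 cl cr lr A0; rewrite /mode wave_opp /wave A0.
have [x [y el]] := cplxP cl; have [x' [y' er]] := cplxP cr.
have nb : b0.1 ^+ 2 + b0.2 ^+ 2 != 0.
  by have := qnorm2_neq0 (ptC_neq0 b00); rewrite /qnorm2 /= expr0n /= !addr0.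
move: A0; rewrite el er /growth /= => -[/eqP + /eqP].
rewrite !mulf_eq0 !invr_eq0 !pnatr_eq0 !orbF oppr_eq0 => /eqP g1 /eqP g2.
(* The two growth equations form a linear system in x - x' and y + y' with determinant |b0|^2 up to
   sign; both unknowns vanish. *)
have /eqP : (b0.1 ^+ 2 + b0.2 ^+ 2) * (x - x') = 0.
  transitivity (b0.2 * (b0.1 * (y + y') + b0.2 * (x - x')) +
                b0.1 * (b0.1 * (x - x') - b0.2 * (y + y'))); first by ring.
  by rewrite g1 g2; ring.
rewrite mulf_eq0 (negbTE nb) /= subr_eq0 => /eqP ex.
have /eqP : (b0.1 ^+ 2 + b0.2 ^+ 2) * (y + y') = 0.
  transitivity (b0.1 * (b0.1 * (y + y') + b0.2 * (x - x')) -
                b0.2 * (b0.1 * (x - x') - b0.2 * (y + y'))); first by ring.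
  by rewrite g1 g2; ring.
rewrite mulf_eq0 (negbTE nb) /= addr_eq0 => /eqP ey.
have n1 : x ^+ 2 = 1 - y ^+ 2.
  by move: lr; rewrite el er -ex => -[]; rewrite ey => e _ _ _; lra.
move: (freq b0 _ _) => u; rewrite /cexp.
have -> : 2 * pi * dot (popp u) z = - (2 * pi * dot u z) by rewrite /dot /=; ring.
have -> v : dot (popp (0, 0)) v = 0 by rewrite /dot /=; ring.
have -> v : dot (0, 0) v = 0 by rewrite /dot /=; ring.
rewrite mulr0 expR0 /expi cosN sinN.
by move: (cos _) (sin _) => C S; apply: quat_eq => /=; ring: n1.
Qed.

Lemma parallel_mode (w1 w2 b0 : R * R) (f : R * R -> quat R) mu
    (alpha : R * R -> quat R) :
  ham_stationary_torus w1 w2 b0 f -> is_cplx mu -> mu <> qzero R ->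
  smoothQ alpha -> (forall z, alpha z <> qzero R) ->
  dmu_parallel b0 f mu alpha -> has_multiplier w1 w2 alpha ->
  exists lam r q, [/\ is_cplx lam, is_cplx r, qmul lam r = qone R, q <> qzero R &
    alpha = fun z => qmul (qmul (expj (beta b0 z / 2)) (mode b0 lam r z)) q].
Proof.
move=> hf cmu mu0 sa a0 pa ma; have [[lb b00] db _ _ _] := hf.
have [r [cr emu]] := cplx_sqrt cmu.
have r0 : r <> qzero R by move=> e; apply: mu0; rewrite emu e qmulq0.
pose lam := qinv r.
have cl : is_cplx lam by case: cr => r2 r3; split; rewrite /= ?r2 ?r3 ?oppr0 mul0r.
have lr : qmul lam r = qone R by exact: qmulVq.
(* Replacing b0 by - b0 inverts the gauge factor, so the gauge derivative lemmas also differentiate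
   phi. *)
pose phi z := qmul (expj (beta (popp b0) z / 2)) (alpha z).
have alphaE : alpha = fun z => qmul (expj (beta b0 z / 2)) (phi z).
  apply/funext => z; rewrite /phi qmulA -expjD.
  have -> : beta b0 z / 2 + beta (popp b0) z / 2 = 0 by rewrite /beta /dot /=; field.
  have -> : expj 0 = qone R by rewrite /expj cos0 sin0.
  by rewrite qmul1q.
have dx z := gauge_derx (popp b0) (smooth_qderx z sa).
have dy z := gauge_dery (popp b0) (smooth_qdery z sa).
move: pa; rewrite emu alphaE => /(dmu_parallel_gauge _ hf dx dy) pa.
have {}dx z : qderx phi z (dmu_x b0 (qmul r r) (phi z)) by rewrite -(pa z).1; exact: dx.
have {}dy z : qdery phi z (dmu_y b0 (qmul r r) (phi z)) by rewrite -(pa z).2; exact: dy.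
have [c1 [c2 [cc1 cc2 phiE]]] := dmu_solution cl cr lr dx dy.
have add0q p : qadd (qzero R) p = p by qring.
have addq0 p : qadd p (qzero R) = p by qring.
have lr' : qmul (qopp lam) (qopp r) = qone R by rewrite qmulNN.
(* With one coefficient zero a single mode remains; for c1 = 0 it is the mode of (- lam, - r). *)
have [c10|n1] := pselect (c1 = qzero R).
  exists (qopp lam), (qopp r), c2; split; rewrite ?qmulNN //; try exact: is_cplx_opp.
    move=> c20; apply: (a0 (0, 0)); rewrite alphaE phiE c10 c20 !qmulq0 addq0 qmulq0 //.
  by apply/funext => z; rewrite phiE c10 qmulq0 add0q qmulA.
have [c20|n2] := pselect (c2 = qzero R).
  exists lam, r, c1; split=> //.
  by apply/funext => z; rewrite phiE c20 qmulq0 addq0 qmulA.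
have A0 : growth b0 lam r = (0, 0).
  apply: (multiplier_growth0 lb db cl cr lr cc1 cc2 n1 n2 _ ma) => z.
  by rewrite alphaE phiE.
(* Zero growth makes the second mode a right multiple of the first, so both coefficients merge into
   one quaternion, nonzero because alpha is. *)
pose q := qadd c1 (qmul (qmul (qJ R) (qopp (qmul (qI R) lam))) c2).
have phiE' z : phi z = qmul (mode b0 lam r z) q.
  by rewrite phiE (mode_opp_growth0 z b00 cl cr lr A0) -qmulA /q qmulDr.
exists lam, r, q; split=> //.
  by move=> q0; apply: (a0 (0, 0)); rewrite alphaE phiE' q0 !qmulq0.
by apply/funext => z; rewrite phiE' qmulA.
Qed.

End Darboux.

Theorem theorem5p5 (R : realType) (w1 w2 b0 : R * R) (f : R * R -> quat R) :
  ham_stationary_torus w1 w2 b0 f ->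
  forall fhat : R * R -> quat R * quat R,
    closed_mu_darboux w1 w2 b0 f fhat <-> mono_darboux w1 w2 b0 f fhat.
Proof.
move=> hf fhat; have [[_ b00] db _ _ _] := hf; split.
- move=> [mu [alpha [cmu mu0 pa ma da]]]; have [sa a0 _ _] := da.
  have [lam [r [q [cl cr lr q0 alphaE]]]] := parallel_mode hf cmu mu0 sa a0 pa ma.
  exists (fun z => qmul (expj (beta b0 z / 2)) (mode b0 lam r z)).
  split; first exact: mode_monochromatic lr.
  (* Right multiplication by the inverse of q strips the constant and keeps the transform. *)
  have := darboux_transform_mulr (qinv_neq0 q0) da; rewrite alphaE.
  by under eq_fun do rewrite -qmulA qmulqV // qmulq1.
- move=> [alpha [mono da]].
  have [lam [r [c [cl cr lr [cc _] alphaE]]]] := monochromatic_mode b00 mono.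
  (* The spectral parameter is mu = lam^-2, for lam the [lambda_d] of the section. *)
  exists (qmul r r), alpha; split=> //.
  + exact: is_cplx_mul.
  + by have [_ r0] := qmul_eq1_neq0 lr; exact: qmul_neq0.
  + by rewrite alphaE; exact: (mode_parallel hf).
  + by rewrite alphaE; exact: mode_multiplier.
Qed.
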